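(* Let $n\ge3$ and let $P$ be a positive-area local optimum. Let $\mathcal L_B(P)=\operatorname{span}\{B(q):q\in\mathcal K(P)\}$, let $C_1,\dots,C_s$ be a basis of $\mathcal L_B(P)$ orthonormal for the Frobenius inner product, and put $G_{\mathrm{sh}}=\sum_{\alpha=1}^sC_\alpha^TC_\alpha$. Then $G_{\mathrm{sh}}$ is independent of the choice of the orthonormal basis, $G_{\mathrm{sh}}\succeq0$, and $$\ker G_{\mathrm{sh}}=K_{\mathrm{sh}}(P),\qquad K_{\mathrm{sh}}(P)^\perp=\sum_{C\in\mathcal L_B(P)}\operatorname{im}C .$$
   Context: A configuration is $P=(p_1,\dots,p_n)$ with $p_i=(x_i,y_i)\in[0,1]^2$. For a triple $t=(i,j,k)$, $i<j<k$, put $D_t(P)=\det(p_j-p_i,p_k-p_i)$, $A_t(P)=\tfrac12|D_t(P)|$, and $\delta(P)=\min_tA_t(P)$. A positive-area local optimum is a local maximizer $P$ of $\delta$ on $([0,1]^2)^n$ with $\Delta:=\delta(P)>0$. Put $s_t=\operatorname{sgn}D_t(P)$; near $P$, $A_t=\tfrac12s_tD_t$, which is used for derivatives. A normalized KKT multiplier at $P$ is a tuple $q=(\lambda,\ell,r,d,u)$ of nonnegative reals $\lambda_t$ (all triples $t$), $\ell_i,r_i,d_i,u_i$ ($i\in[n]$) with: $\lambda_t=0$ unless $A_t(P)=\Delta$; $\ell_i=0$ unless $x_i=0$, $r_i=0$ unless $x_i=1$, $d_i=0$ unless $y_i=0$, $u_i=0$ unless $y_i=1$; $\sum_t\lambda_t=1$;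 and $\sum_t\lambda_t\nabla_{p_i}A_t(P)+(\ell_i-r_i,d_i-u_i)=0$ for all $i$. The set of these is the KKT polytope $\mathcal K(P)$. For $t=(i,j,k)$, $i<j<k$, let $B_t=s_t(a_tc_t^T-c_ta_t^T)\in\mathbb R^{n\times n}$ with $a_t=e_j-e_i$, $c_t=e_k-e_i$. For $q\in\mathcal K(P)$ let $B(q)=\sum_t\lambda_tB_t$, a skew-symmetric matrix. The shared kernel is $K_{\mathrm{sh}}(P)=\bigcap_{q\in\mathcal K(P)}\ker B(q)\subset\mathbb R^n$. The Frobenius inner product is $\langle C,C'\rangle=\operatorname{tr}(C^TC')$ on skew-symmetric $n\times n$ matrices; $\perp$ is with respect to the standard inner product of $\mathbb R^n$. *)

(* Defs.v *)
From mathcomp Require Import all_boot all_order all_algebra.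
From mathcomp Require Import all_classical all_reals all_analysis.

Set Implicit Arguments.
Unset Strict Implicit.
Unset Printing Implicit Defensive.

Import Order.TTheory GRing.Theory Num.Theory.
Import numFieldNormedType.Exports.

Local Open Scope classical_set_scope.
Local Open Scope ring_scope.

Definition triple (n : nat) : finType :=
  {t : 'I_n * 'I_n * 'I_n | (t.1.1 < t.1.2)%N && (t.1.2 < t.2)%N}.

Definition ti n (t : triple n) : 'I_n := (sval t).1.1.
Definition tj n (t : triple n) : 'I_n := (sval t).1.2.
Definition tk n (t : triple n) : 'I_n := (sval t).2.

(* A configuration of n points is a 2 x n matrix P: column i is p_i, so that
   x_i = P 0 i and y_i = P 1 i. *)
Definition square (R : realType) (n : nat) : set 'M[R]_(2, n) :=
  [set P | forall c i, 0 <= P c i <= 1].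

Definition det_area (R : realType) n (P : 'M[R]_(2, n)) (t : triple n) : R :=
  \det (row_mx (col (tj t) P - col (ti t) P) (col (tk t) P - col (ti t) P)
        : 'M[R]_2).

Definition area (R : realType) n (P : 'M[R]_(2, n)) (t : triple n) : R :=
  2^-1 * `|det_area P t|.

(* The infimum is over a finite set, nonempty when 3 <= n, hence a minimum:
   see min_areaP. *)
Definition min_area (R : realType) n (P : 'M[R]_(2, n)) : R :=
  inf (range (area P)).

Lemma min_areaP (R : realType) n (P : 'M[R]_(2, n)) : (3 <= n)%N ->
  (exists t, min_area P = area P t) /\ (forall t, min_area P <= area P t).
Proof.
move=> n3.
have t0 : triple n.
  exists (Ordinal (ltnW (ltnW n3)), Ordinal (ltnW n3), Ordinal n3).
  by [].
have [t _ tmin] := @Order.TotalTheory.arg_minP _ _ _ t0 xpredT (area P) isT.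
suff E : min_area P = area P t by split=> [|t']; [exists t|rewrite E tmin].
apply/eqP; rewrite eq_le; apply/andP; split.
  apply: ge_inf; last by exists t.
  by exists (area P t) => _ [t' _ <-]; exact: tmin.
apply: lb_le_inf; first by exists (area P t), t.
by move=> _ [t' _ <-]; exact: tmin.
Qed.

Definition positive_area_local_optimum (R : realType) n (P : 'M[R]_(2, n)) :
    Prop :=
  [/\ square P,
      \forall Q \near within (@square R n) (nbhs P), min_area Q <= min_area P
    & 0 < min_area P].

(* Gradient at P, with respect to p_i, of Q |-> s_t D_t(Q) / 2, where the sign
   s_t = sgn D_t(P) is frozen at P. *)
Definition grad_area (R : realType) n (P : 'M[R]_(2, n)) (t : triple n)
    (i : 'I_n) : 'cV[R]_2 :=
  \col_(c < 2)
    'D_(delta_mx c i) (fun Q => 2^-1 * (Num.sg (det_area P t) * det_area Q t)) P.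

Record multiplier (R : realType) (n : nat) := Multiplier {
  mul_t : triple n -> R;
  mul_l : 'I_n -> R;
  mul_r : 'I_n -> R;
  mul_d : 'I_n -> R;
  mul_u : 'I_n -> R
}.

Record is_KKT (R : realType) n (P : 'M[R]_(2, n)) (q : multiplier R n) : Prop :=
  IsKKT {
  KKT_t_ge0 : forall t, 0 <= mul_t q t;
  KKT_l_ge0 : forall i, 0 <= mul_l q i;
  KKT_r_ge0 : forall i, 0 <= mul_r q i;
  KKT_d_ge0 : forall i, 0 <= mul_d q i;
  KKT_u_ge0 : forall i, 0 <= mul_u q i;
  KKT_t_active : forall t, area P t <> min_area P -> mul_t q t = 0;
  KKT_l_active : forall i, P 0 i <> 0 -> mul_l q i = 0;
  KKT_r_active : forall i, P 0 i <> 1 -> mul_r q i = 0;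
  KKT_d_active : forall i, P 1 i <> 0 -> mul_d q i = 0;
  KKT_u_active : forall i, P 1 i <> 1 -> mul_u q i = 0;
  KKT_normalized : \sum_t mul_t q t = 1;
  KKT_stationary : forall i,
    \sum_t mul_t q t *: grad_area P t i
    + \col_(c < 2) (if c == 0 then mul_l q i - mul_r q i
                    else mul_d q i - mul_u q i) = 0
}.

Definition KKT_polytope (R : realType) n (P : 'M[R]_(2, n)) :
  set (multiplier R n) := [set q | is_KKT P q].

Definition B_triple (R : realType) n (P : 'M[R]_(2, n)) (t : triple n) :
    'M[R]_n :=
  let a : 'cV[R]_n := delta_mx (tj t) 0 - delta_mx (ti t) 0 in
  let c : 'cV[R]_n := delta_mx (tk t) 0 - delta_mx (ti t) 0 in
  Num.sg (det_area P t) *: (a *m c^T - c *m a^T).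

Definition B_mult (R : realType) n (P : 'M[R]_(2, n)) (q : multiplier R n) :
    'M[R]_n :=
  \sum_t mul_t q t *: B_triple P t.

(* R^n is the space of column vectors; the library's kermx and row spaces act
   on row vectors instead, hence the set-valued kernel and images below. *)
Definition mxker (R : realType) n (M : 'M[R]_n) : set 'cV[R]_n :=
  [set v | M *m v = 0].

Definition shared_kernel (R : realType) n (P : 'M[R]_(2, n)) : set 'cV[R]_n :=
  \bigcap_(q in KKT_polytope P) mxker (B_mult P q).

(* Linear span of a possibly infinite set: the vectors spanned by finitely many
   of its elements. *)
Definition lin_span (R : realType) (V : vectType R) (S : set V) : set V :=
  [set v | exists2 s : seq V, [set` s] `<=` S & v \in span s].

Definition L_B (R : realType) n (P : 'M[R]_(2, n)) : set 'M[R]_n :=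
  lin_span (B_mult P @` KKT_polytope P).

Definition frobenius (R : realType) n (C C' : 'M[R]_n) : R := \tr (C^T *m C').

Definition frobenius_onb (R : realType) n (L : set 'M[R]_n) s
    (C : s.-tuple 'M[R]_n) : Prop :=
  [/\ free C, [set` span C] = L
    & forall a b : 'I_s, frobenius (tnth C a) (tnth C b) = (a == b)%:R].

Definition gram_sum (R : realType) n s (C : s.-tuple 'M[R]_n) : 'M[R]_n :=
  \sum_(a < s) (tnth C a)^T *m tnth C a.

Definition psd (R : realType) n (G : 'M[R]_n) : Prop :=
  G^T = G /\ forall v : 'cV[R]_n, 0 <= (v^T *m G *m v) 0 0.

Definition orthocomp (R : realType) n (K : set 'cV[R]_n) : set 'cV[R]_n :=
  [set w | forall v, K v -> (v^T *m w) 0 0 = 0].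

(* The sum of the subspaces im C, for C in S: all finite sums of vectors each
   taken from one of the images. *)
Definition sum_images (R : realType) n (S : set 'M[R]_n) : set 'cV[R]_n :=
  [set w | exists (m : nat) (C : 'I_m -> 'M[R]_n) (v : 'I_m -> 'cV[R]_n),
     (forall a, S (C a)) /\ w = \sum_(a < m) C a *m v a].

(* Main.v *)
Require Import Defs.
From mathcomp Require Import all_boot all_order all_algebra.
From mathcomp Require Import all_classical all_reals all_analysis.

(** For any finite family [C] of real matrices, [v^T G v = sum |C_a v|^2], so the
    kernel of [G = sum C_a^T C_a] is the common kernel of the [C_a], hence of
    their span. As [G] is symmetric, the orthogonal of its kernel is its image;
    and since the [C_a] are skew, [G u = sum C_a (- C_a u)] lies in the sum of
    their images. *)

Import Order.TTheory GRing.Theory Num.Theory.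

Local Open Scope classical_set_scope.
Local Open Scope ring_scope.

(** Take a finite family in [S] whose span has maximal dimension: appending further elements of [S]
    cannot enlarge that span. This turns [L_B P], spanned by a possibly infinite set, into the span
    of a tuple. *)
Lemma lin_span_finite {R : realType} {V : vectType R} (S : set V) :
  exists2 s : seq V, [set` s] `<=` S & lin_span S = [set` span s].
Proof.
pose Q d := `[< exists2 s : seq V, [set` s] `<=` S & \dim (span s) = d >].
have exQ : exists d, Q d.
  by exists (\dim (span [::] : {vspace V})); apply/asboolP; exists nil.
have ubQ d : Q d -> (d <= \dim {: V})%N.
  by move=> /asboolP[s _ <-]; exact/dimvS/subvf.
case: (ex_maxnP exQ ubQ) => d /asboolP[s sS ds] dmax.
exists s => //; apply/seteqP; split=> v /=; last by exists s.
move=> [s' s'S vs'].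
have sub : (span s <= span (s ++ s'))%VS by rewrite span_cat addvSl.
have /eqP -> : span s == span (s ++ s').
  rewrite eqEdim sub ds dmax//; apply/asboolP; exists (s ++ s') => //.
  by move=> x; rewrite /= mem_cat => /orP[/sS|/s'S].
by rewrite span_cat; apply: subvP (addvSr _ _) _ vs'.
Qed.

Lemma trmx_mul_self {R : realType} {n : nat} (w : 'cV[R]_n) :
  (w^T *m w) 0 0 = \sum_i w i 0 ^+ 2.
Proof. by rewrite mxE; apply: eq_bigr => i _; rewrite mxE expr2. Qed.

Lemma trmx_mul_self_ge0 {R : realType} {n : nat} (w : 'cV[R]_n) :
  0 <= (w^T *m w) 0 0.
Proof. by rewrite trmx_mul_self sumr_ge0// => i _; exact: sqr_ge0. Qed.

Lemma trmx_mul_self_eq0 {R : realType} {n : nat} (w : 'cV[R]_n) :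
  (w^T *m w) 0 0 = 0 -> w = 0.
Proof.
rewrite trmx_mul_self => /eqP; rewrite psumr_eq0 => [/allP w0|i _]; last first.
  exact: sqr_ge0.
apply/matrixP => i j; rewrite ord1 mxE; apply/eqP.
by rewrite -sqrf_eq0; apply: w0; rewrite mem_index_enum.
Qed.

Section GramSum.
Context {R : realType} {n s : nat}.
Implicit Type C : s.-tuple 'M[R]_n.

Lemma gram_sum_tr C : (gram_sum C)^T = gram_sum C.
Proof.
rewrite /gram_sum raddf_sum; apply: eq_bigr => a _.
by rewrite /= trmx_mul trmxK.
Qed.

Lemma gram_sum_quad C (v : 'cV[R]_n) : (v^T *m gram_sum C *m v) 0 0 =
  \sum_a ((tnth C a *m v)^T *m (tnth C a *m v)) 0 0.
Proof.
rewrite /gram_sum mulmx_sumr mulmx_suml summxE; apply: eq_bigr => a _.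
by rewrite trmx_mul !mulmxA.
Qed.

Lemma gram_sum_psd C : psd (gram_sum C).
Proof.
split=> [|v]; first exact: gram_sum_tr.
by rewrite gram_sum_quad sumr_ge0// => a _; exact: trmx_mul_self_ge0.
Qed.

(** If [G v = 0], the quadratic form at [v] is a vanishing sum of squared norms, so every term
    vanishes. The tuple is arbitrary, so that the lemma also applies to a spanning family that is
    not orthonormal. *)
Lemma mxker_gram_sum C :
  mxker (gram_sum C) = \bigcap_(M in [set` span C]) mxker M.
Proof.
apply/seteqP; split=> v; rewrite /mxker /=.
- move=> Gv M /= MC; rewrite (coord_span MC) mulmx_suml big1// => a _.
  rewrite -scalemxAl -tnth_nth (_ : _ *m v = 0) ?scaler0//.
  apply: trmx_mul_self_eq0; apply/eqP.
  have := gram_sum_quad C v; rewrite -mulmxA Gv mulmx0 mxE => /esym/eqP.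
  rewrite psumr_eq0 => [/allP|b _]; last exact: trmx_mul_self_ge0.
  by apply; rewrite mem_index_enum.
- move=> h; rewrite /gram_sum mulmx_suml big1// => a _.
  by rewrite -mulmxA (h (tnth C a)) ?mulmx0//= memv_span// mem_tnth.
Qed.

End GramSum.

Lemma frobenius_sym {R : realType} {n : nat} (A B : 'M[R]_n) :
  frobenius A B = frobenius B A.
Proof. by rewrite /frobenius -mxtrace_tr trmx_mul trmxK. Qed.

Lemma frobenius_onb_expand {R : realType} {n s : nat} (L : set 'M[R]_n)
    (C : s.-tuple 'M[R]_n) (X : 'M[R]_n) : frobenius_onb L C -> L X ->
  X = \sum_a frobenius (tnth C a) X *: tnth C a.
Proof.
move=> [_ CL on]; rewrite -CL /= => XC.
rewrite {1}(coord_span XC); apply: eq_bigr => a _; rewrite -tnth_nth.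
congr (_ *: _); rewrite {2}(coord_span XC) /frobenius mulmx_sumr raddf_sum.
rewrite (bigD1 a)//= big1 ?addr0 => [|b ba].
  rewrite -tnth_nth -scalemxAr mxtraceZ.
  by have := on a a; rewrite /frobenius eqxx => ->; rewrite mulr1.
rewrite -tnth_nth -scalemxAr mxtraceZ.
by have := on a b; rewrite /frobenius eq_sym (negPf ba) => ->; rewrite mulr0.
Qed.

Lemma frobenius_onb_mem {R : realType} {n s : nat} (L : set 'M[R]_n)
    (C : s.-tuple 'M[R]_n) (a : 'I_s) : frobenius_onb L C -> L (tnth C a).
Proof. by move=> [_ <- _]; rewrite /= memv_span// mem_tnth. Qed.

(** Both sides equal the double sum over [a], [b] of [frobenius C_a C'_b] times [C_a^T C'_b]. *)
Lemma gram_sum_onb {R : realType} {n s s' : nat} (L : set 'M[R]_n)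
    (C : s.-tuple 'M[R]_n) (C' : s'.-tuple 'M[R]_n) :
  frobenius_onb L C -> frobenius_onb L C' -> gram_sum C' = gram_sum C.
Proof.
move=> hC hC'; rewrite /gram_sum.
(* Only the transposed factor [C'_b] is expanded in [C]. *)
under eq_bigr => b _.
  rewrite {1}(frobenius_onb_expand _ _ _ hC (frobenius_onb_mem _ _ b hC')).
  rewrite raddf_sum mulmx_suml; over.
rewrite exchange_big; apply: eq_bigr => a _ /=.
(* On the other side, the right factor [C_a] is expanded in [C']. *)
rewrite [X in _ = _ *m X](frobenius_onb_expand _ _ _ hC'
  (frobenius_onb_mem _ _ a hC)).
rewrite mulmx_sumr; apply: eq_bigr => b _.
by rewrite linearZ /= -scalemxAl -scalemxAr frobenius_sym.
Qed.

Lemma B_mult_skew {R : realType} {n : nat} (P : 'M[R]_(2, n)) q :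
  (B_mult P q)^T = - B_mult P q.
Proof.
rewrite /B_mult raddf_sum -sumrN; apply: eq_bigr => t _ /=.
rewrite linearZ -scalerN /B_triple linearZ -scalerN /=.
by rewrite linearB /= !trmx_mul !trmxK opprB.
Qed.

Lemma lin_span_skew {R : realType} {n : nat} (S : set 'M[R]_n) :
  (forall M, S M -> M^T = - M) -> forall M, lin_span S M -> M^T = - M.
Proof.
move=> Sskew M [s sS Ms].
rewrite (@coord_span _ _ _ (in_tuple s) M Ms) raddf_sum -sumrN.
apply: eq_bigr => a _; rewrite -scalerN [LHS]linearZ /=; congr (_ *: _).
by apply/Sskew/sS; rewrite /= mem_nth.
Qed.

Lemma L_B_skew {R : realType} {n : nat} (P : 'M[R]_(2, n)) (M : 'M[R]_n) :
  L_B P M -> M^T = - M.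
Proof. by apply: lin_span_skew => _ [q _ <-]; exact: B_mult_skew. Qed.

Lemma shared_kernelE {R : realType} {n : nat} (P : 'M[R]_(2, n)) :
  shared_kernel P = \bigcap_(M in L_B P) mxker M.
Proof.
apply/seteqP; split=> v h.
- move=> M [s sS Ms]; rewrite /mxker /=.
  rewrite (@coord_span _ _ _ (in_tuple s) M Ms) mulmx_suml big1// => a _.
  have [|q Kq <-] := sS s`_a; first by rewrite /= mem_nth.
  by rewrite -scalemxAl (h q Kq) scaler0.
- move=> q Kq; apply: h; exists [:: B_mult P q]; last first.
    by rewrite memv_span// mem_head.
  by move=> M; rewrite /= inE => /eqP ->; exists q.
Qed.

(** Orthogonality to the kernel puts [w^T] in the row space of [G]; transposing, symmetry makes it
    the column space. *)
Lemma orthocomp_mxker_sym {R : realType} {n : nat} (G : 'M[R]_n) (w : 'cV[R]_n) :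
  G^T = G -> orthocomp (mxker G) w -> exists u, w = G *m u.
Proof.
move=> Gsym wG.
suff /submxP[D wD] : (w^T <= G)%MS.
  by exists D^T; rewrite -{1}Gsym -trmx_mul -wD trmxK.
(* Membership in the row space means [w^T *m cokermx G = 0], and the columns of [cokermx G] lie in
   the kernel of [G]. *)
rewrite submxE; apply/eqP/matrixP => i j; rewrite ord1 [RHS]mxE.
have kerj : mxker G (col j (cokermx G)).
  by rewrite /mxker /= colE mulmxA mulmx_coker mul0mx.
rewrite -{}[RHS](wG _ kerj) !mxE; apply: eq_bigr => k _.
by rewrite !mxE mulrC.
Qed.

Theorem theorem5p3 (R : realType) (n : nat) (n3 : (3 <= n)%N)
    (P : 'M[R]_(2, n)) (hP : positive_area_local_optimum P) :
  (forall (s : nat) (C : s.-tuple 'M[R]_n), frobenius_onb (L_B P) C ->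
     [/\ forall (s' : nat) (C' : s'.-tuple 'M[R]_n),
           frobenius_onb (L_B P) C' -> gram_sum C' = gram_sum C,
         psd (gram_sum C)
       & mxker (gram_sum C) = shared_kernel P])
  /\ orthocomp (shared_kernel P) = sum_images (L_B P).
Proof.
split=> [s C hC|].
  split=> [s' C' hC'||]; [exact: gram_sum_onb hC hC'|exact: gram_sum_psd|].
  by case: hC => _ CL _; rewrite mxker_gram_sum CL shared_kernelE.
rewrite shared_kernelE; apply/seteqP; split=> w.
(* This identity mentions no basis, so the Gram sum of any finite spanning family serves. *)
- have [s _ Ls] := lin_span_finite (B_mult P @` KKT_polytope P).
  pose C := in_tuple s.
  have CL : L_B P = [set` span C] by rewrite /L_B Ls.
  rewrite CL -mxker_gram_sum => /orthocomp_mxker_sym[|u ->].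
    exact: gram_sum_tr.
  have LC a : [set` span C] (tnth C a) by rewrite /= memv_span// mem_tnth.
  (* By skewness, [C_a^T C_a u = C_a (- C_a u)]. *)
  exists (size s), (tnth C), (fun a => - (tnth C a *m u)); split=> //.
  rewrite /gram_sum mulmx_suml; apply: eq_bigr => a _.
  by rewrite (@L_B_skew _ _ P) ?CL// mulNmx mulNmx mulmxN mulmxA.
- move=> [m [C [u [LC ->]]]] v vK.
  rewrite mulmx_sumr summxE big1// => a _.
  (* Skewness again: [v^T C_a = - (C_a v)^T], which is zero on the common kernel. *)
  rewrite mulmxA -[C a]trmxK -trmx_mul (L_B_skew P)// mulNmx.
  by rewrite (vK _ (LC a)) oppr0 trmx0 mul0mx mxE.
Qed.
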